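(* Let $B$ be a six-manifold with a symplectic $\mathrm{SU}(3)$-structure $(g_B,\omega,\psi_c=\psi_++i\psi_-)$ (so $d\omega=0$) and an effective multi-Hamiltonian action of $T^2$ preserving the $\mathrm{SU}(3)$-structure, with generators $X_1,X_2$ and moment map $\mu=(\mu_1,\mu_2)$, $d\mu_i=\omega(X_i,\cdot)$. Let $\pi\colon M\to B$ be a principal circle bundle with $T^2$-invariant connection one-form $\theta$ and curvature $F$ ($d\theta=\pi^*F$), let $\lambda=(\lambda_1,\lambda_2)$ satisfy $d\lambda_i=-F(X_i,\cdot)$ and define the lifted $T^3$-action on $M$ generated by $U_1,U_2,U_3$ as in the context. Let $h$ be a smooth positive $T^2$-invariant function on $B$ such that the three-form $$\varphi=\theta\wedge\pi^*\omega+\pi^*(h^{3/4}\psi_+)$$ is closed, and let $\nu=(\nu_1,\nu_2,\nu_3)$ be a multi-moment map for the $T^3$-action on $(M,\varphi)$, with additive constants chosen so that $(\nu_1,\nu_2)=\pi^*(\mu_1,\mu_2)$. Consider a compact edge of the graph $\Gamma_B$ of $B$, joining vertices represented by the $T^2$-fixed points $b,c\in B$, whose interior points have one-dimensional stabiliser generated by the primitive vector $\mathsf X=r_1\mathsf X_1+r_2\mathsf X_2$, and let $\mathcal E\subset B$ be the corresponding closed surface, oriented as in the context. Put $t=[\omega]\cap[\mathcal E]$. Then $$\mu(c)-\mu(b)=t\,(-r_2,r_1),\qquad \lambda(c)-\lambda(b)=-\big([F]\cap[\mathcal E]\big)(-r_2,r_1),$$ and, for any points of $M$ projecting to $b$ and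 $c$ (again denoted $b$ and $c$), $$\nu(c)-\nu(b)=t\,\big(-r_2,\;r_1,\;r_1\lambda_1(b)+r_2\lambda_2(b)\big)=t\,\big(-r_2,\;r_1,\;r_1\lambda_1(c)+r_2\lambda_2(c)\big).$$
   Context: $T^2=\mathbb R^2/\mathbb Z^2$, $T^3=\mathbb R^3/\mathbb Z^3$; manifolds are connected. $\mathsf X_1,\mathsf X_2$ is a $\mathbb Z$-basis of the integral lattice of $\mathrm{Lie}(T^2)$, and $X_1,X_2$ are the generated vector fields on $B$. The action is multi-Hamiltonian if there are invariant functions $\mu_1,\mu_2$ on $B$ with $d\mu_i=\omega(X_i,\cdot)$; then $\omega(X_1,X_2)=0$ and all stabilisers are connected subtori. Graph. Let $B^0\subset B$ be the set of points with non-trivial $T^2$-stabiliser. $\Gamma_B=B^0/T^2\subset B/T^2$ is a trivalent graph: its vertices are the $T^2$-fixed points, and its (open) edges are the connected components of the set of orbits with one-dimensional stabiliser, the stabiliser being constant along each edge. The map $\mu$ sends each edge injectively to part of a straight line. A compact edge is one joining two vertices. Circle bundle. $F\in\Omega^2(B)$ is closed, $T^2$-invariant and has integral periods. $\pi\colon M\to B$ is a principal circle bundle whose principal action is generated by a vector field $U_3$ of fundamental period $1$, with $T^2$-invariant connection one-form $\theta$, $\theta(U_3)=1$, $d\theta=\pi^*F$. The functions $\lambda_1,\lambda_2$ on $B$ satisfy $d\lambda_i=-F(X_i,\cdot)$ (also $\lambda_i$ denotes $\pi^*\lambda_i$), and are such that $U_1,U_2,U_3$ generate an effective $T^3$-action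 on $M$, where $$U_1=\tilde X_2+\lambda_2U_3,\qquad -U_2=\tilde X_1+\lambda_1U_3,$$ $\tilde X\in\ker\theta$ being the horizontal lift of $X$. The form $\varphi$ defines a $T^3$-invariant $G_2$-structure on $M$ (with metric $\theta^2\pi^*(h^{-1})+\pi^*(h^{1/2}g_B)$). A multi-moment map is an invariant function $\nu\colon M\to\mathbb R^3$ with $d\nu_i=\varphi(U_j,U_k,\cdot)$ for $(ijk)$ a cyclic permutation of $(123)$. The surface $\mathcal E$. Choose $\mathsf Z=z_1\mathsf X_1+z_2\mathsf X_2$ with $z_1,z_2\in\mathbb Z$ and $r_1z_2-r_2z_1=1$. Let $\tau\colon[0,1]\to B$ be a path from $b$ to $c$, lying over the given edge, with $\mu(\tau(a))=(1-a)\mu(b)+a\mu(c)$. Then $\mathcal E=T^2\cdot\tau([0,1])$, and $[\mathcal E]\in H_2(B,\mathbb Z)$ is the class of the singular cycle $(s,a)\mapsto\exp(s\mathsf Z)\cdot\tau(a)$, $(s,a)\in[0,1]^2$. For a closed two-form $\alpha$, $[\alpha]\cap[\mathcal E]=\int_{\mathcal E}\alpha$. *)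

(* Defs.v *)
From HB Require Import structures.
From mathcomp Require Import all_boot all_order all_algebra perm generic_quotient.
From mathcomp Require Import complex.
From mathcomp Require Import all_classical all_reals all_analysis.

Set Implicit Arguments.
Unset Strict Implicit.
Unset Printing Implicit Defensive.

Import Order.TTheory GRing.Theory Num.Theory.
Import numFieldNormedType.Exports.

Local Open Scope classical_set_scope.
Local Open Scope ring_scope.
Local Open Scope quotient_scope.

(* Smooth maps between normed spaces. [smooth_on U f] is only used for open
   [U]: it says that all iterated directional derivatives of [f] exist and are
   differentiable on [U]. *)

Fixpoint Ck (R : realType) (V W : normedModType R) (k : nat) (U : set V)
    (f : V -> W) : Prop :=
  match k with
  | 0 => forall x, U x -> {for x, continuous f}
  | k'.+1 => (forall x, U x -> differentiable f x) /\
             forall v : V, Ck k' U (fun x => 'D_v f x)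
  end.

Definition smooth_on (R : realType) (V W : normedModType R) (U : set V)
  (f : V -> W) : Prop := forall k, Ck k U f.

(* Smooth manifolds. *)

Record chart (R : realType) (n : nat) (T : topologicalType) := Chart {
  dom : set T;
  cod : set 'rV[R]_n;
  to_chart : T -> 'rV[R]_n;
  of_chart : 'rV[R]_n -> T;
  open_dom : open dom;
  open_cod : open cod;
  to_chart_cod : forall p, dom p -> cod (to_chart p);
  of_chart_dom : forall x, cod x -> dom (of_chart x);
  to_chartK : forall p, dom p -> of_chart (to_chart p) = p;
  of_chartK : forall x, cod x -> to_chart (of_chart x) = x;
  to_chart_continuous : forall p, dom p -> {for p, continuous to_chart};
  of_chart_continuous : forall x, cod x -> {for x, continuous of_chart}
}.

(* The atlas is the range of [chart_at], which also selects a preferred chart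
   around each point. The tangent space at [p] is ['rV[R]_n], a tangent vector
   being given by its components in the chart [chart_at p]. *)
Record manifold (R : realType) (n : nat) := Manifold {
  carrier :> topologicalType;
  chart_at : carrier -> chart R n carrier;
  chart_at_dom : forall p, dom (chart_at p) p;
  chart_compat : forall p q : carrier,
    smooth_on (cod (chart_at p) `&` of_chart (chart_at p) @^-1` dom (chart_at q))
      (to_chart (chart_at q) \o of_chart (chart_at p));
  manifold_hausdorff : hausdorff_space carrier;
  manifold_second_countable : @second_countable carrier;
  manifold_connected : connected [set: carrier]
}.

Definition coords (R : realType) (n : nat) (B : manifold R n) (p : B) :
  'rV[R]_n := to_chart (chart_at p) p.

Definition smooth_into (R : realType) (V : normedModType R) (n : nat)
    (N : manifold R n) (U : set V) (f : V -> N) : Prop :=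
  (forall x, U x -> {for x, continuous f}) /\
  forall q : N, smooth_on (U `&` f @^-1` dom (chart_at q))
                  (to_chart (chart_at q) \o f).

Definition smooth_map_on (R : realType) (m n : nat) (B : manifold R m)
    (N : manifold R n) (D : set B) (f : B -> N) : Prop :=
  forall p : B,
    smooth_into (cod (chart_at p) `&` of_chart (chart_at p) @^-1` D)
      (f \o of_chart (chart_at p)).

Definition smooth_fun_on (R : realType) (n : nat) (B : manifold R n)
    (D : set B) (f : B -> R) : Prop :=
  forall p : B,
    smooth_on (cod (chart_at p) `&` of_chart (chart_at p) @^-1` D)
      (f \o of_chart (chart_at p) : 'rV[R]_n -> R^o).

Definition smooth_fun (R : realType) (n : nat) (B : manifold R n)
  (f : B -> R) : Prop := smooth_fun_on setT f.

(* Differential of a map from a normed space to a manifold. *)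
Definition diff_into (R : realType) (V : normedModType R) (n : nat)
    (N : manifold R n) (f : V -> N) (x v : V) : 'rV[R]_n :=
  'D_v (to_chart (chart_at (f x)) \o f) x.

Definition velocity (R : realType) (n : nat) (N : manifold R n) (c : R -> N)
  (t : R) : 'rV[R]_n := @diff_into R R^o n N c t 1.

Definition tangent_map (R : realType) (m n : nat) (B : manifold R m)
    (N : manifold R n) (f : B -> N) (p : B) (v : 'rV[R]_m) : 'rV[R]_n :=
  'D_v (to_chart (chart_at (f p)) \o f \o of_chart (chart_at p)) (coords p).

Definition dfun (R : realType) (n : nat) (B : manifold R n) (f : B -> R)
    (p : B) (v : 'rV[R]_n) : R :=
  'D_v (f \o of_chart (chart_at p) : 'rV[R]_n -> R^o) (coords p).

(* Covariant tensor fields and differential forms. *)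

Definition tensor (R : realType) (n : nat) (k : nat) (B : manifold R n) :=
  B -> ('I_k -> 'rV[R]_n) -> R.

Definition args (R : realType) (n k : nat) (s : seq 'rV[R]_n) :
  'I_k -> 'rV[R]_n := fun i => nth 0 s i.

Definition replace (R : realType) (n k : nat) (v : 'I_k -> 'rV[R]_n) (i : 'I_k)
  (w : 'rV[R]_n) : 'I_k -> 'rV[R]_n := fun j => if j == i then w else v j.

(* Components of a tensor field in the chart [chart_at q]. *)
Definition in_chart (R : realType) (n k : nat) (B : manifold R n)
    (alpha : tensor k B) (q : B) (x : 'rV[R]_n) (v : 'I_k -> 'rV[R]_n) : R :=
  alpha (of_chart (chart_at q) x)
    (fun i => diff_into (of_chart (chart_at q)) x (v i)).

Record smooth_tensor (R : realType) (n k : nat) (B : manifold R n)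
    (alpha : tensor k B) : Prop := {
  tensor_multilinear : forall (p : B) v i (a : R) u w,
    alpha p (replace v i (a *: u + w)) =
    a * alpha p (replace v i u) + alpha p (replace v i w);
  tensor_smooth : forall (q : B) v,
    smooth_on (cod (chart_at q))
      ((fun x => in_chart alpha q x v) : 'rV[R]_n -> R^o)
}.

Record is_form (R : realType) (n k : nat) (B : manifold R n)
    (alpha : tensor k B) : Prop := {
  form_smooth : smooth_tensor alpha;
  form_alternating : forall p v (i j : 'I_k),
    i != j -> v i = v j -> alpha p v = 0
}.

Definition pullback (R : realType) (m n k : nat) (B : manifold R m)
    (N : manifold R n) (f : B -> N) (alpha : tensor k N) : tensor k B :=
  fun p v => alpha (f p) (fun i => tangent_map f p (v i)).

(* (theta ^ omega)(u, v, w) = theta(u) omega(v, w) + cyclic, for degrees 1, 2. *)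
Definition wedge (R : realType) (n k l : nat) (B : manifold R n)
    (alpha : tensor k B) (beta : tensor l B) : tensor (k + l) B :=
  fun p v => ((k`! * l`!)%N%:R)^-1 * \sum_(s : 'S_(k + l))
    (-1) ^+ s * alpha p (fun i => v (s (lshift l i)))
              * beta p (fun j => v (s (rshift k j))).

(* d alpha (v_0, ..., v_k) = sum_i (-1)^i v_i (alpha (.., v_i omitted, ..)),
   computed at [p] with vector fields constant in the chart [chart_at p]. *)
Definition ext_d (R : realType) (n k : nat) (B : manifold R n)
    (alpha : tensor k B) : tensor k.+1 B :=
  fun p v => \sum_(i < k.+1) (-1) ^+ i *
    'D_(v i) ((fun x => in_chart alpha p x (fun j => v (lift i j)))
                : 'rV[R]_n -> R^o) (coords p).

Definition closed_form (R : realType) (n k : nat) (B : manifold R n)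
  (alpha : tensor k B) : Prop := forall p v, ext_d alpha p v = 0.

Definition pulled_back2 (R : realType) (n : nat) (B : manifold R n)
    (alpha : tensor 2 B) (S : R -> R -> B) (s a : R) : R :=
  alpha (S s a) (args [:: velocity (S ^~ a) s; velocity (S s) a]).

(* Integral periods: integer values on the smooth singular 2-cycles
   [\sum_j c j * sigma j], where the simplices [sigma j] are parametrised by
   the triangle 0 <= x, 0 <= y, x + y <= 1. *)

Definition face (T : Type) (R : realType) (sigma : R -> R -> T) (i : 'I_3)
    (s : R) : T :=
  match val i with
  | 0 => sigma (1 - s) s
  | 1 => sigma 0 s
  | _ => sigma s 0
  end.

Definition is_cycle2 (T : Type) (R : realType) (N : nat) (c : 'I_N -> int)
    (sigma : 'I_N -> R -> R -> T) : Prop :=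
  forall gamma : R -> T,
    \sum_(j < N) \sum_(i < 3)
      (if `[< forall s : R, 0 <= s <= 1 -> face (sigma j) i s = gamma s >]
       then (-1) ^+ i * c j else 0) = 0 :> int.

Definition smooth_simplex2 (R : realType) (n : nat) (B : manifold R n)
    (sigma : R -> R -> B) : Prop :=
  exists U : set (R^o * R^o)%type, [/\ open U,
    forall x y : R, 0 <= x -> 0 <= y -> x + y <= 1 -> U (x, y) &
    smooth_into U (fun z : R^o * R^o => sigma z.1 z.2)].

Definition integral_periods (R : realType) (n : nat) (B : manifold R n)
    (alpha : tensor 2 B) : Prop :=
  forall (N : nat) (c : 'I_N -> int) (sigma : 'I_N -> R -> R -> B),
    (forall j, smooth_simplex2 (sigma j)) -> is_cycle2 c sigma ->
    \sum_(j < N) (c j)%:~R *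
      (\int[lebesgue_measure]_(x in `[0%R, 1%R])
         \int[lebesgue_measure]_(y in `[0%R, 1 - x])
            pulled_back2 alpha (sigma j) x y) \is a Num.int.

(* Actions of the torus R^k / Z^k, given as actions of R^k trivial on Z^k. *)

Definition integral_vector (R : realType) (k : nat) (s : 'rV[R]_k) : Prop :=
  forall i, s 0 i \is a Num.int.

Record torus_action (R : realType) (k n : nat) (B : manifold R n) :=
  TorusAction {
  act :> 'rV[R]_k -> B -> B;
  act0 : forall p, act 0 p = p;
  actD : forall s t p, act (s + t) p = act s (act t p);
  act_integral : forall s p, integral_vector s -> act s p = p;
  act_smooth : forall p : B,
    smooth_into [set y : 'rV[R]_k * 'rV[R]_n | cod (chart_at p) y.2]
      (fun y => act y.1 (of_chart (chart_at p) y.2))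
}.

Definition effective (R : realType) (k n : nat) (B : manifold R n)
    (A : torus_action k B) : Prop :=
  forall s, (forall p, A s p = p) -> integral_vector s.

(* The vector field generated by the i-th vector of the standard basis of the
   integral lattice. *)
Definition generator (R : realType) (k n : nat) (B : manifold R n)
    (A : torus_action k B) (i : 'I_k) (p : B) : 'rV[R]_n :=
  velocity (fun x : R => A (x *: delta_mx 0 i) p) 0.

Definition invariant_fun (R : realType) (k n : nat) (B : manifold R n)
    (A : torus_action k B) (T : Type) (f : B -> T) : Prop :=
  forall s p, f (A s p) = f p.

Definition invariant_tensor (R : realType) (k n l : nat) (B : manifold R n)
    (A : torus_action k B) (alpha : tensor l B) : Prop :=
  forall s p v, pullback (A s) alpha p v = alpha p v.

(* Orbit space, with its quotient topology. *)

Definition orbit_rel (R : realType) (k n : nat) (B : manifold R n)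
    (A : torus_action k B) : rel B :=
  fun p q => `[< exists s, A s p = q >].

Lemma orbit_rel_equiv (R : realType) (k n : nat) (B : manifold R n)
  (A : torus_action k B) : equiv_class_of (orbit_rel A).
Proof.
split.
- by move=> p; apply/asboolP; exists 0; exact: act0.
- have sym p q : orbit_rel A p q -> orbit_rel A q p.
    move=> /asboolP[s <-]; apply/asboolP; exists (- s).
    by rewrite -actD addNr act0.
  by move=> p q; apply/idP/idP; exact: sym.
- move=> q p r /asboolP[s <-] /asboolP[t <-]; apply/asboolP; exists (t + s).
  exact: actD.
Qed.

Definition orbit_equiv (R : realType) (k n : nat) (B : manifold R n)
    (A : torus_action k B) : equiv_rel B :=
  EquivRelPack (orbit_rel_equiv A).

Definition orbit_space (R : realType) (k n : nat) (B : manifold R n)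
    (A : torus_action k B) : topologicalType :=
  quotient_topology {eq_quot (orbit_equiv A)}.

Definition orbit_pt (R : realType) (k n : nat) (B : manifold R n)
    (A : torus_action k B) (p : B) : orbit_space A :=
  (\pi_({eq_quot (orbit_equiv A)}) p)%qT.

(* The Lie algebra of the stabiliser of [p] is a line. *)
Definition stabiliser_dim1 (R : realType) (k n : nat) (B : manifold R n)
    (A : torus_action k B) (p : B) : Prop :=
  exists2 v : 'rV[R]_k, v != 0 &
    forall w : 'rV[R]_k,
      (forall x : R, A (x *: w) p = p) <-> exists y : R, w = y *: v.

(* The stabiliser of [p] is the subgroup [exp (R v)] of the torus. *)
Definition stabiliser_generated_by (R : realType) (k n : nat)
    (B : manifold R n) (A : torus_action k B) (p : B) (v : 'rV[R]_k) : Prop :=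
  forall s : 'rV[R]_k,
    A s p = p <-> exists x : R, integral_vector (s - x *: v).

(* The graph [B^0 / T^2]: vertices and open edges. *)
Definition fixed_point (R : realType) (k n : nat) (B : manifold R n)
    (A : torus_action k B) (p : B) : Prop := forall s, A s p = p.

Definition open_edge (R : realType) (k n : nat) (B : manifold R n)
    (A : torus_action k B) (e : set (orbit_space A)) : Prop :=
  exists2 p : B, stabiliser_dim1 A p &
    e = connected_component (orbit_pt A @` [set q | stabiliser_dim1 A q]) (orbit_pt A p).

Definition edge_joins (R : realType) (k n : nat) (B : manifold R n)
    (A : torus_action k B) (e : set (orbit_space A)) (b c : B) : Prop :=
  [/\ fixed_point A b, fixed_point A c &
      closure e = e `|` [set orbit_pt A b; orbit_pt A c]].

(* SU(3)-structures. Pointwise, [z j = x_j + i y_j] ([j < 3]) is a linear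
   identification of the tangent space with C^3 for which
     g = sum_j dx_j^2 + dy_j^2,  omega = sum_j dx_j ^ dy_j,
     psi_+ + i psi_- = dz_0 ^ dz_1 ^ dz_2. *)
Definition su3_adapted (R : realType)
    (g omega : ('I_2 -> 'rV[R]_6) -> R) (psip psim : ('I_3 -> 'rV[R]_6) -> R)
    (P Q : 'M[R]_(6, 3)) : Prop :=
  let x j (v : 'rV[R]_6) : R := (v *m P) 0 j in
  let y j (v : 'rV[R]_6) : R := (v *m Q) 0 j in
  let dz (v : 'I_3 -> 'rV[R]_6) : R[i] :=
    \det (\matrix_(i < 3, j < 3) (Complex (x i (v j)) (y i (v j)))) in
  [/\ forall u v, g (args [:: u; v]) = \sum_j (x j u * x j v + y j u * y j v),
      forall u v, omega (args [:: u; v]) =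
        \sum_j (x j u * y j v - y j u * x j v) &
      forall v, Complex (psip v) (psim v) = dz v].

Record symplectic_SU3 (R : realType) (B : manifold R 6) (g omega : tensor 2 B)
    (psip psim : tensor 3 B) : Prop := {
  SU3_metric : smooth_tensor g;
  SU3_omega : is_form omega;
  SU3_psip : is_form psip;
  SU3_psim : is_form psim;
  SU3_frame : forall p, exists P Q : 'M[R]_(6, 3),
    row_mx P Q \in unitmx /\
    su3_adapted (g p) (omega p) (psip p) (psim p) P Q;
  SU3_symplectic : closed_form omega
}.

(* [mu] is a moment map: it makes the action multi-Hamiltonian. *)
Definition is_moment_map (R : realType) (k n : nat) (B : manifold R n)
    (A : torus_action k B) (omega : tensor 2 B) (mu : B -> 'rV[R]_k) : Prop :=
  invariant_fun A mu /\
  forall i, smooth_fun (fun p => mu p 0 i) /\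
    forall p v, dfun (fun q => mu q 0 i) p v =
                omega p (args [:: generator A i p; v]).

(* Principal circle bundles. Over [V] the equivariant trivialisation is
   (p, e^{2 pi i t}) |-> rot t (sigma p), with inverse m |-> (pi m, u m + i v m),
   both being smooth. *)
Record principal_circle_bundle (R : realType) (n l : nat) (M : manifold R n)
    (B : manifold R l) (proj : M -> B) (rot : torus_action 1 M) : Prop := {
  proj_smooth : smooth_map_on setT proj;
  proj_rot : forall s m, proj (rot s m) = proj m;
  locally_trivial : forall b, exists (V : set B) (sigma : B -> M) (u v : M -> R),
    [/\ open V /\ V b,
        smooth_map_on V sigma /\ (forall p, V p -> proj (sigma p) = p),
        smooth_fun_on (proj @^-1` V) u /\ smooth_fun_on (proj @^-1` V) v,
        forall m, V (proj m) -> exists t : R,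
          m = rot (const_mx t) (sigma (proj m)) &
        forall p (t : R), V p ->
          u (rot (const_mx t) (sigma p)) = cos (2 * pi * t) /\
          v (rot (const_mx t) (sigma p)) = sin (2 * pi * t)]
}.

Record connection_form (R : realType) (n : nat) (M : manifold R n)
    (rot : torus_action 1 M) (theta : tensor 1 M) : Prop := {
  connection_smooth : is_form theta;
  connection_invariant : invariant_tensor rot theta;
  connection_normalised : forall m, theta m (args [:: generator rot 0 m]) = 1
}.

Definition horizontal_lift (R : realType) (n l : nat) (M : manifold R n)
    (B : manifold R l) (proj : M -> B) (theta : tensor 1 M) (m : M)
    (X : 'rV[R]_l) (w : 'rV[R]_n) : Prop :=
  theta m (args [:: w]) = 0 /\ tangent_map proj m w = X.

(* U_1 = X~_2 + lambda_2 U_3,  - U_2 = X~_1 + lambda_1 U_3,  and U_3 generates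
   the principal action; indices are shifted by one. *)
Definition lifted_action (R : realType) (n l : nat) (M : manifold R n)
    (B : manifold R l) (proj : M -> B) (rot : torus_action 1 M)
    (theta : tensor 1 M) (A : torus_action 2 B) (lambda : B -> 'rV[R]_2)
    (A3 : torus_action 3 M) : Prop :=
  forall m : M,
  let U i := generator A3 i m in
  let U3 := generator rot 0 m in
  [/\ horizontal_lift proj theta m (generator A 1 (proj m))
        (U 0 - lambda (proj m) 0 1 *: U3),
      horizontal_lift proj theta m (generator A 0 (proj m))
        (- U 1 - lambda (proj m) 0 0 *: U3) &
      U 2%:R = U3].

Definition g2_form (R : realType) (n l : nat) (M : manifold R n)
    (B : manifold R l) (proj : M -> B) (theta : tensor 1 M)
    (omega : tensor 2 B) (psip : tensor 3 B) (h : B -> R) : tensor 3 M :=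
  fun m v =>
    wedge theta (pullback proj omega) m v +
    pullback proj (fun p w => (h p `^ (3 / 4)) * psip p w) m v.

(* d nu_i = phi(U_j, U_k, .) for (i j k) cyclic; the sums of indices are taken
   modulo 3. *)
Definition is_multi_moment_map (R : realType) (n : nat) (M : manifold R n)
    (A3 : torus_action 3 M) (phi : tensor 3 M) (nu : M -> 'rV[R]_3) : Prop :=
  invariant_fun A3 nu /\
  forall i : 'I_3, smooth_fun (fun m => nu m 0 i) /\
    forall m v, dfun (fun m' => nu m' 0 i) m v =
      phi m (args [:: generator A3 (i + 1) m; generator A3 (i + 2%:R) m; v]).

(* A path as in the definition of the surface [E]. It cannot be required to be
   smooth at its end points, where the moment map is critical. *)
Record edge_path (R : realType) (n : nat) (B : manifold R n)
    (A : torus_action 2 B) (mu : B -> 'rV[R]_2) (e : set (orbit_space A))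
    (b c : B) (tau : R -> B) : Prop := {
  path_continuous : {within `[0%R, 1%R], continuous tau};
  path_smooth : @smooth_into R R^o n B `]0%R, 1%R[ tau;
  path_source : tau 0 = b;
  path_target : tau 1 = c;
  path_over_edge : forall a, 0 < a < 1 -> e (orbit_pt A (tau a));
  path_moment : forall a, 0 <= a <= 1 ->
    mu (tau a) = (1 - a) *: mu b + a *: mu c
}.

(* The pairing of [alpha] with the class of the cycle
   (s, a) |-> exp(s Z) . tau(a) on [0, 1]^2. It is the integral of [alpha] over
   the surface swept out; as [tau] is smooth on ]0, 1[ only, the integral is
   taken over [0, 1] x [x, 1 - x] with x -> 0+. *)
Definition surface_pairing (R : realType) (n : nat) (B : manifold R n)
    (A : torus_action 2 B) (Z : 'rV[R]_2) (tau : R -> B) (alpha : tensor 2 B) :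
    R :=
  lim ((\int[lebesgue_measure]_(a in `[x, 1 - x])
          \int[lebesgue_measure]_(s in `[0%R, 1%R])
             pulled_back2 alpha (fun s a => A (s *: Z) (tau a)) s a)
       @[x --> (0 : R)^'+]).

Definition row_of (R : realType) (k : nat) (s : seq R) : 'rV[R]_k :=
  \row_j s`_j.

(* Main.v *)
Require Import Defs.
From mathcomp Require Import all_boot all_order all_algebra perm generic_quotient.
From mathcomp Require Import all_classical all_reals all_analysis.
From mathcomp Require Import ring lra.

Import Order.TTheory GRing.Theory Num.Theory.
Import numFieldNormedType.Exports.

Local Open Scope classical_set_scope.
Local Open Scope ring_scope.

(* Let [alpha] be an invariant 2-form with [alpha(X_i, .) = df_i] (up to sign).
   By invariance, [alpha] pulled back along (s, a) |-> exp(sZ) tau(a) equals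
   [alpha(Z, tau') = (z.f o tau)'(a)], whatever [s], so its integral is the
   increment of [z.f] along the edge; since [r.X] vanishes on the edge, [r.f] is
   constant there, and the two equations determine the increment of [f]. This
   covers both [mu] and [lambda].
   The third component of [nu] is invariant under the principal circle action,
   whose generator is that of the third circle of [A3]; hence it descends to [B].
   On the edge [X_1] and [X_2] are proportional, so that
   [d nu_3 = lambda_1 d mu_2 - lambda_2 d mu_1 = t (r.lambda) da] there, and
   [r.lambda] is constant. *)

(** * First-order calculus on the line *)

Section FirstOrderCalculus.
Set Implicit Arguments.
Unset Strict Implicit.
Context {R : realType}.

Lemma derive_comp (V W : normedModType R) (F : V -> W) (x : R -> V) (t : R) :
  differentiable x t -> differentiable F (x t) ->
  'D_1 (F \o x) t = 'D_('D_1 x t) F (x t).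
Proof.
move=> dx dF; have dFx : differentiable (F \o x) t by exact: differentiable_comp.
by rewrite (deriveE _ dFx) (deriveE _ dx) (deriveE _ dF) diff_comp.
Qed.

Lemma smooth_on_differentiable (V W : normedModType R) (U : set V) (f : V -> W) x :
  smooth_on U f -> U x -> differentiable f x.
Proof. by move=> /(_ 1%N)[+ _]; exact. Qed.

Lemma near_eq_differentiable (W : normedModType R) (f g : R -> W) (t : R) :
  (\forall s \near t, f s = g s) -> differentiable f t -> differentiable g t.
Proof.
move=> fg /derivable1_diffP df; apply/derivable1_diffP.
exact: near_eq_derivable df.
Qed.

Lemma cst_of_derive0 (f : R -> R) :
  (forall t, differentiable f t) -> (forall t, 'D_1 f t = 0) ->
  forall s t, f s = f t.
Proof.
move=> df f0 s t; apply: is_derive_0_is_cst => x.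
by apply: DeriveDef; [exact/derivable1_diffP|exact: f0].
Qed.

(** The mean value theorem on [[0, b]]. Nothing is asked of the derivative at 0 and 1, where the
    edge path may fail to be smooth; continuity carries the conclusion up to [b = 1]. *)
Lemma increment_of_derive_cst (f : R -> R) (k b : R) : 0 < b <= 1 ->
  {within `[0%R, 1%R], continuous f} ->
  (forall t : R, 0 < t < 1 -> differentiable f t) ->
  (forall t : R, 0 < t < 1 -> 'D_1 f t = k) -> f b - f 0 = k * b.
Proof.
move=> /andP[b0 b1] fc df fk.
have {}fc : {within `[0%R, b], continuous f}.
  by apply: continuous_subspaceW fc; apply: subset_itvl; rewrite bnd_simp.
have [|c _ ->] := @MVT _ f (fun=> k) 0 b b0 _ fc; last by rewrite subr0.
move=> x; rewrite in_itv/= => /andP[x0 xb].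
have x01 : 0 < x < 1 by rewrite x0 (lt_le_trans xb).
by apply: DeriveDef; [exact/derivable1_diffP/df|exact: fk].
Qed.

End FirstOrderCalculus.

(** * Differentiability along curves in a manifold, read in charts *)

Section Curves.
Set Implicit Arguments.
Unset Strict Implicit.
Context {R : realType}.

(** [to_chart] is arbitrary off the domain of its chart, so differentiability of the chart
    expression does not keep [c] in that domain near [t]; continuity is asked for separately. The
    same holds for [map_diff]. *)
Definition curve_diff {n} (N : manifold R n) (c : R -> N) (t : R) : Prop :=
  {for t, continuous c} /\
  differentiable (to_chart (chart_at (c t)) \o c : R -> 'rV[R]_n) t.

Definition map_diff {m n} (B : manifold R m) (N : manifold R n) (f : B -> N)
    (p : B) : Prop :=
  {for p, continuous f} /\
  differentiable (to_chart (chart_at (f p)) \o f \o of_chart (chart_at p))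
    (coords p).

Definition fun_diff {n} (B : manifold R n) (f : B -> R) (p : B) : Prop :=
  {for p, continuous f} /\
  differentiable (f \o of_chart (chart_at p) : 'rV[R]_n -> R) (coords p).

Lemma near_dom n (T : topologicalType) (N : manifold R n) (c : T -> N) t q :
  {for t, continuous c} -> dom (chart_at q) (c t) ->
  \forall s \near t, dom (chart_at q) (c s).
Proof. by move=> cc cq; apply: cc; exact: open_nbhs_nbhs (conj (open_dom _) cq). Qed.

Lemma near_chartK n (T : topologicalType) (N : manifold R n) (c : T -> N) t :
  {for t, continuous c} ->
  \forall s \near t, of_chart (chart_at (c t)) (to_chart (chart_at (c t)) (c s)) = c s.
Proof.
move=> cc; have := near_dom cc (chart_at_dom (c t)).
by apply: filterS => s; exact: to_chartK.
Qed.

Lemma coords_cod n (N : manifold R n) (p : N) : cod (chart_at p) (coords p).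
Proof. exact/to_chart_cod/chart_at_dom. Qed.

Lemma coordsK n (N : manifold R n) (p : N) : of_chart (chart_at p) (coords p) = p.
Proof. exact/to_chartK/chart_at_dom. Qed.

Lemma coords_continuous n (N : manifold R n) (p : N) :
  {for p, continuous (to_chart (chart_at p))}.
Proof. exact/to_chart_continuous/chart_at_dom. Qed.

Lemma continuous_of_chart m (B : manifold R m) (T : topologicalType) (f : B -> T) p :
  {for coords p, continuous (f \o of_chart (chart_at p))} -> {for p, continuous f}.
Proof.
move=> fc.
have c : {for p, continuous ((f \o of_chart (chart_at p)) \o to_chart (chart_at p))}.
  by apply: continuous_comp => //; exact: coords_continuous.
have h : ((f \o of_chart (chart_at p)) \o to_chart (chart_at p)) x @[x --> p] -->
    f (of_chart (chart_at p) (to_chart (chart_at p) p)) := c.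
rewrite to_chartK in h; last exact: chart_at_dom.
apply: cvg_trans h; apply: near_eq_cvg.
have := near_chartK (c := id) (t := p) (@cvg_id _ _).
by apply: filterS => s /= ->.
Qed.

(** The chain rule in coordinates. Passing through the chart at [c t] and back is the identity only
    near [t], which suffices because differentiation is local. *)
Lemma curve_diff_map m n (B : manifold R m) (N : manifold R n) (f : B -> N) c t :
  curve_diff c t -> map_diff f (c t) ->
  curve_diff (f \o c) t /\
  velocity (f \o c) t = tangent_map f (c t) (velocity c t).
Proof.
move=> [cc dc] [fc df].
have cfc : {for t, continuous (f \o c)} by exact: continuous_comp.
have E : \forall s \near t,
    ((to_chart (chart_at (f (c t))) \o f \o of_chart (chart_at (c t))) \o
      (to_chart (chart_at (c t)) \o c)) s = (to_chart (chart_at (f (c t))) \o (f \o c)) s.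
  by have := near_chartK cc; apply: filterS => s /= ->.
split; first split=> //.
  by apply: near_eq_differentiable E _; exact: differentiable_comp.
by rewrite /velocity /diff_into -(near_eq_derive _ E) derive_comp.
Qed.

Lemma derive_fun_curve n (B : manifold R n) (f : B -> R) c t :
  curve_diff c t -> fun_diff f (c t) ->
  differentiable (f \o c) t /\ 'D_1 (f \o c) t = dfun f (c t) (velocity c t).
Proof.
move=> [cc dc] [fc df].
have E : \forall s \near t,
    ((f \o of_chart (chart_at (c t))) \o
      (to_chart (chart_at (c t)) \o c)) s = (f \o c) s.
  by have := near_chartK cc; apply: filterS => s /= ->.
split; first by apply: near_eq_differentiable E _; exact: differentiable_comp.
by rewrite -(near_eq_derive _ E) derive_comp.
Qed.

Lemma smooth_into_curve_diff n (N : manifold R n) (U : set R) (c : R -> N) t :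
  @smooth_into R R^o n N U c -> U t -> curve_diff c t.
Proof.
move=> [cc dc] Ut; split; first exact: cc.
by apply: (smooth_on_differentiable (dc (c t))); split=> //; exact: chart_at_dom.
Qed.

Lemma smooth_map_on_diff m n (B : manifold R m) (N : manifold R n) D (f : B -> N) p :
  smooth_map_on D f -> D p -> map_diff f p.
Proof.
move=> /(_ p)[fc fs] Dp.
have Up : (cod (chart_at p) `&` of_chart (chart_at p) @^-1` D) (coords p).
  by split; [exact: coords_cod|rewrite /preimage/= coordsK].
split; first exact/continuous_of_chart/fc.
rewrite -compA; apply: (smooth_on_differentiable (fs (f p))); split=> //=.
by rewrite coordsK; exact: chart_at_dom.
Qed.

Lemma smooth_fun_diff n (B : manifold R n) (f : B -> R) p :
  smooth_fun f -> fun_diff f p.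
Proof.
move=> sf.
have df : differentiable (f \o of_chart (chart_at p) : 'rV[R]_n -> R) (coords p).
  exact: smooth_on_differentiable (sf p) (conj (coords_cod p) I).
by split=> //; apply: continuous_of_chart; exact: differentiable_continuous.
Qed.

Lemma tangent_map_linear m n (B : manifold R m) (N : manifold R n) (f : B -> N) p :
  map_diff f p -> linear (tangent_map f p).
Proof.
move=> [_ df] a u v.
by rewrite /tangent_map !(deriveE _ df) linearP.
Qed.

End Curves.

(** * Velocities of torus orbits *)

Section Actions.
Set Implicit Arguments.
Unset Strict Implicit.
Context {R : realType}.

Lemma curve_diff_shift n (N : manifold R n) (c : R -> N) (a t : R) :
  curve_diff c (t + a) ->
  curve_diff (fun s => c (s + a)) t /\
  velocity (fun s => c (s + a)) t = velocity c (t + a).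
Proof.
move=> [cc dc]; split; last first.
  rewrite /velocity /diff_into /derive; congr (lim (_ @ 0^')).
  by apply/funext => h /=; rewrite addrA.
have dsh : differentiable (fun s : R => s + a) t by [].
split; last by have := differentiable_comp dsh dc.
by have := continuous_comp (differentiable_continuous dsh) cc.
Qed.

Definition fundamental_field k n (B : manifold R n) (A : torus_action k B)
    (Z : 'rV[R]_k) (p : B) : 'rV[R]_n := \sum_i Z 0 i *: generator A i p.

Section Action.
Context {k n : nat} {B : manifold R n} (A : torus_action k B).

Lemma act_differentiable s p :
  differentiable (fun y : 'rV[R]_k * 'rV[R]_n =>
    to_chart (chart_at (A s p)) (A y.1 (of_chart (chart_at p) y.2))) (s, coords p).
Proof.
have [_ sm] := act_smooth A p.
apply: (smooth_on_differentiable (sm (A s p))); split => /=.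
  exact: coords_cod.
by rewrite coordsK; exact: chart_at_dom.
Qed.

Lemma act_continuous s p :
  {for (s, coords p), continuous (fun y : 'rV[R]_k * 'rV[R]_n =>
    A y.1 (of_chart (chart_at p) y.2))}.
Proof. by have [sm _] := act_smooth A p; apply: sm; exact: coords_cod. Qed.

Lemma act_map_diff s p : map_diff (A s) p.
Proof.
have d : differentiable (fun x : 'rV[R]_n => (s, x)) (coords p).
  by apply: differentiable_pair.
split; last exact: (differentiable_comp d (act_differentiable s p)).
apply: continuous_of_chart.
by have := continuous_comp (differentiable_continuous d) (@act_continuous s p).
Qed.

(** All these velocities are values of one linear map, the differential at 0 of [y |-> A y p]; its
    values on the standard basis are the generators. *)
Lemma act_curve0 (Z : 'rV[R]_k) p :
  curve_diff (fun u => A (u *: Z) p) 0 /\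
  velocity (fun u => A (u *: Z) p) 0 = fundamental_field A Z p.
Proof.
pose G y := to_chart (chart_at p) (A y p).
have d : differentiable (fun y : 'rV[R]_k => (y, coords p)) 0.
  by apply: differentiable_pair.
have dG : differentiable G 0.
  have := differentiable_comp d (act_differentiable 0 p).
  rewrite act0; congr (differentiable _ _).
  by apply/funext => y /=; rewrite coordsK.
have dl (W : 'rV[R]_k) : differentiable (fun u : R => u *: W) 0 by [].
have Dl (W : 'rV[R]_k) : 'D_1 (fun u : R => u *: W) 0 = W.
  by rewrite (deriveE _ (dl W)) diff_val scale1r.
have z (W : 'rV[R]_k) : A (0 *: W) p = p by rewrite scale0r act0.
have vel W : velocity (fun u => A (u *: W) p) 0 = 'd G 0 W.
  have -> : velocity (fun u => A (u *: W) p) 0 = 'D_1 (G \o (fun u : R => u *: W)) 0.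
    by rewrite /velocity /diff_into z.
  by rewrite derive_comp ?scale0r // Dl deriveE.
split.
  split.
    have dc : continuous_at (0 : R) (fun u : R => (u *: Z, coords p)).
      apply: differentiable_continuous; exact: differentiable_pair.
    have h : {for (0 : R), continuous ((fun y : 'rV[R]_k * 'rV[R]_n =>
          A y.1 (of_chart (chart_at p) y.2)) \o (fun u : R => (u *: Z, coords p)))}.
      by apply: continuous_comp => //; rewrite scale0r; exact: act_continuous.
    have <- : (fun y : 'rV[R]_k * 'rV[R]_n =>
          A y.1 (of_chart (chart_at p) y.2)) \o (fun u : R => (u *: Z, coords p)) =
          (fun u => A (u *: Z) p) by apply/funext => u /=; rewrite coordsK.
    exact: h.
  rewrite z; have := differentiable_comp (dl Z).
  by move=> /(_ _ G); rewrite scale0r; exact.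
rewrite vel [Z in LHS]row_sum_delta linear_sum.
by apply: eq_bigr => i _; rewrite linearZ /= -vel.
Qed.

(** Factoring [exp(uZ)] as [exp((u - s)Z)] followed by [exp(sZ)] gives the velocity as a
    push-forward, the form in which invariance of a tensor applies. *)
Lemma act_curve (Z : 'rV[R]_k) p (s : R) :
  curve_diff (fun u => A (u *: Z) p) s /\
  velocity (fun u => A (u *: Z) p) s =
    tangent_map (A (s *: Z)) p (fundamental_field A Z p).
Proof.
have [c0 v0] := act_curve0 Z p.
have E : (fun u => A (u *: Z) p) =
    (fun u => (A (s *: Z) \o (fun u => A (u *: Z) p)) (u - s)).
  by apply/funext => u /=; rewrite -actD -scalerDl addrC subrK.
have z : A (0 *: Z) p = p by rewrite scale0r act0.
have m : map_diff (A (s *: Z)) ((fun u => A (u *: Z) p) 0) by exact: act_map_diff.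
have [c1 v1] := curve_diff_map c0 m.
have := @curve_diff_shift _ _ (A (s *: Z) \o (fun u => A (u *: Z) p)) (- s) s.
rewrite -E subrr => /(_ c1)[c2 v2]; split=> //.
by rewrite v2 v1 v0 z.
Qed.

(** The same factorisation with [exp(sZ)] acting first, so that the remaining curve starts at the
    moved point. *)
Lemma act_curve_velocity (Z : 'rV[R]_k) p (s : R) :
  velocity (fun u => A (u *: Z) p) s = fundamental_field A Z (A (s *: Z) p).
Proof.
have [c0 v0] := act_curve0 Z (A (s *: Z) p).
have E : (fun u => A (u *: Z) p) =
    (fun u => (fun u => A (u *: Z) (A (s *: Z) p)) (u - s)).
  by apply/funext => u /=; rewrite -actD -scalerDl subrK.
have := @curve_diff_shift _ _ (fun u => A (u *: Z) (A (s *: Z) p)) (- s) s.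
by rewrite -E subrr => /(_ c0)[_ ->].
Qed.

Lemma velocity_cst (p : B) (t : R) : velocity (fun=> p) t = 0.
Proof. exact: derive_cst. Qed.

Lemma fundamental_field_stabiliser (Z : 'rV[R]_k) p :
  (forall u : R, A (u *: Z) p = p) -> fundamental_field A Z p = 0.
Proof.
move=> fx; have [_ <-] := act_curve0 Z p.
by under eq_fun do rewrite fx; exact: velocity_cst.
Qed.

Lemma fundamental_field_delta (i : 'I_k) p :
  fundamental_field A (delta_mx 0 i) p = generator A i p.
Proof. by have [_ <-] := act_curve0 (delta_mx 0 i) p. Qed.

End Action.
End Actions.

(** * Multilinearity of tensors on explicit argument lists *)

Section Tensors.
Set Implicit Arguments.
Unset Strict Implicit.
Context {R : realType} {n k : nat} {B : manifold R n}.

Lemma replace_args (s : seq 'rV[R]_n) (i : 'I_k) w :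
  replace (args s) i w = args (set_nth 0 s i w).
Proof. by apply/funext => j; rewrite /replace /args nth_set_nth /= -val_eqE. Qed.

Lemma args_map (m : nat) (f : 'rV[R]_n -> 'rV[R]_m) (s : seq 'rV[R]_n) :
  size s = k -> (fun i : 'I_k => f (@args R n k s i)) = args (map f s).
Proof.
by move=> sk; apply/funext => i; rewrite /args (nth_map 0) // sk.
Qed.

Lemma pullback_args (m : nat) (N : manifold R m) (f : B -> N) (beta : tensor k N) p s :
  size s = k ->
  pullback f beta p (args s) = beta (f p) (args (map (tangent_map f p) s)).
Proof. by move=> sk; rewrite /pullback args_map. Qed.

Context (alpha : tensor k B) (al : smooth_tensor alpha) (p : B).

(** [set_nth] computes on a literal list, so this form of linearity, unlike the one with [replace],
    applies directly to a tensor evaluated on listed vectors. *)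
Lemma tensor_args_linear (s : seq 'rV[R]_n) (i : 'I_k) a u w :
  alpha p (args (set_nth 0 s i (a *: u + w))) =
  a * alpha p (args (set_nth 0 s i u)) + alpha p (args (set_nth 0 s i w)).
Proof. by rewrite -!replace_args tensor_multilinear. Qed.

Lemma tensor_args0 (s : seq 'rV[R]_n) (i : 'I_k) :
  alpha p (args (set_nth 0 s i 0)) = 0.
Proof.
(* With coefficient -1 the two terms on the right cancel. *)
have := tensor_args_linear s i (-1) 0 0.
by rewrite scaler0 addr0 mulN1r addNr.
Qed.

Lemma tensor_argsZ (s : seq 'rV[R]_n) (i : 'I_k) a u :
  alpha p (args (set_nth 0 s i (a *: u))) = a * alpha p (args (set_nth 0 s i u)).
Proof. by rewrite -{1}(addr0 (a *: u)) tensor_args_linear tensor_args0 addr0. Qed.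

Lemma tensor_args_sum m (s : seq 'rV[R]_n) (i : 'I_k) (a : 'I_m -> R) u :
  alpha p (args (set_nth 0 s i (\sum_j a j *: u j))) =
  \sum_j a j * alpha p (args (set_nth 0 s i (u j))).
Proof.
elim/big_rec2: _ => [|j x y _ <-]; first exact: tensor_args0.
exact: tensor_args_linear.
Qed.

End Tensors.

(** * Bilinear algebra of two-forms *)

Section TwoForms.
Set Implicit Arguments.
Unset Strict Implicit.
Context {R : realType} {n : nat} {B : manifold R n}.
Context (alpha : tensor 2 B) (al : is_form alpha) (p : B).

Lemma form2_linear_l u u' v (a : R) :
  alpha p (args [:: a *: u + u'; v]) =
  a * alpha p (args [:: u; v]) + alpha p (args [:: u'; v]).
Proof. exact: (tensor_args_linear (form_smooth al) p [:: 0; v] 0). Qed.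

Lemma form2_linear_r u v v' (a : R) :
  alpha p (args [:: u; a *: v + v']) =
  a * alpha p (args [:: u; v]) + alpha p (args [:: u; v']).
Proof. exact: (tensor_args_linear (form_smooth al) p [:: u; 0] 1). Qed.

Lemma form2_alternating u : alpha p (args [:: u; u]) = 0.
Proof. by apply: (form_alternating al _ _ (i := 0) (j := 1)). Qed.

Lemma form2_antisym u v : alpha p (args [:: u; v]) = - alpha p (args [:: v; u]).
Proof.
(* Polarisation; the factor 1 gives [u + v] the shape that linearity expects. *)
have := form2_alternating (1 *: u + v).
rewrite form2_linear_l !form2_linear_r !form2_alternating => H; lra.
Qed.

Lemma form2_Z u v (a : R) :
  (alpha p (args [:: a *: u; v]) = a * alpha p (args [:: u; v])) *
  (alpha p (args [:: u; a *: v]) = a * alpha p (args [:: u; v])).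
Proof.
split; first exact: (tensor_argsZ (form_smooth al) p [:: 0; v] 0).
exact: (tensor_argsZ (form_smooth al) p [:: u; 0] 1).
Qed.

End TwoForms.

(** * Integrating derivatives along a path smooth only in the interior *)

Section Calculus.
Set Implicit Arguments.
Unset Strict Implicit.
Context {R : realType}.

(** In the fixed chart at [tau a] the derivative is the sum of the [x_i'] times the partial
    derivatives of [g] along [x], and smoothness to order 2 makes each factor continuous. The
    fundamental theorem of calculus needs such an integrand. *)
Lemma derive_fun_curve_continuous n (B : manifold R n) (f : B -> R) (tau : R -> B)
    (U : set R) (a : R) :
  smooth_fun f -> open U -> @smooth_into R R^o n B U tau -> U a ->
  {for a, continuous (fun s => 'D_1 (f \o tau) s)}.
Proof.
move=> sf oU [tc ts] Ua.
pose p := tau a; pose g : 'rV[R]_n -> R := f \o of_chart (chart_at p).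
pose x : R -> 'rV[R]_n := to_chart (chart_at p) \o tau.
pose W : set R := U `&` tau @^-1` dom (chart_at p).
have Wa : W a by split => //; exact: chart_at_dom.
have dx s : W s -> differentiable x s.
  by move=> Ws; exact: smooth_on_differentiable (ts p) Ws.
have dg y : cod (chart_at p) y -> differentiable g y.
  by move=> py; apply: (smooth_on_differentiable (sf p)); split.
have cx s : W s -> cod (chart_at p) (x s) by move=> [_ /=]; exact: to_chart_cod.
have WN s : W s -> \forall r \near s, W r.
  move=> [Us ds]; apply: filterI; first exact: open_nbhs_nbhs.
  exact: near_dom (tc s Us) ds.
have E : \forall s \near a, 'D_1 (f \o tau) s =
    \sum_(i < n) ('D_1 x s) 0 i * 'D_(delta_mx 0 i) g (x s).
  apply: filterS (WN a Wa) => s Ws.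
  have -> : 'D_1 (f \o tau) s = 'D_1 (g \o x) s.
    apply: near_eq_derive; apply: filterS (WN s Ws) => r [_ /=] dr.
    by rewrite /g /x /= to_chartK.
  rewrite derive_comp; [|exact: dx|exact/dg/cx].
  rewrite deriveE; last exact/dg/cx.
  rewrite [X in 'd g _ X]row_sum_delta linear_sum.
  by apply: eq_bigr => i _; rewrite linearZ (deriveE _ (dg _ (cx _ Ws))).
have C : {for a, continuous (fun s => \sum_(i < n) ('D_1 x s) 0 i * 'D_(delta_mx 0 i) g (x s))}.
  have xa : {for a, continuous x} by exact/differentiable_continuous/dx.
  have x'a : {for a, continuous (fun s => 'D_1 x s)}.
    have [_ /(_ 1)[+ _]] := ts p 2%N.
    by move=> /(_ a Wa) /differentiable_continuous.
  have g'a i : {for x a, continuous (fun y => 'D_(delta_mx 0 i) g y)}.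
    have [_ /(_ (delta_mx 0 i))[+ _]] := sf p 2%N.
    move=> /(_ (x a)) h; apply: differentiable_continuous; apply: h.
    by split; [exact: cx|].
  apply: cvg_big => [|i _]; [exact: add_continuous|apply: cvgM].
    have := continuous_comp x'a (@coord_continuous _ _ _ 0 i _).
    exact.
  by have := continuous_comp xa (g'a i).
(* The formula also holds at [a] itself, which identifies the limit. *)
rewrite /prop_for /continuous_at (nbhs_singleton E).
apply: cvg_trans C; apply: near_eq_cvg.
by apply: filterS E => s ->.
Qed.

(** The fundamental theorem on [[x, 1 - x]] yields [H (1 - x) - H x]; continuity of [H] at 0 and 1
    gives the limit, whatever the derivative does there. *)
Lemma lim_integral_derive (H G : R -> R) :
  {within `[0%R, 1%R], continuous H} ->
  (forall a : R, 0 < a < 1 -> differentiable H a) ->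
  (forall a : R, 0 < a < 1 -> {for a, continuous (fun s => 'D_1 H s)}) ->
  (forall a : R, 0 < a < 1 -> G a = 'D_1 H a) ->
  lim ((\int[lebesgue_measure]_(a in `[x, 1 - x]) G a) @[x --> (0 : R)^'+])
  = H 1 - H 0.
Proof.
move=> Hc dH cH GH.
have [cH' H0 H1] := (continuous_within_itvP H ltr01).1 Hc.
apply/cvg_lim => //.
have L : (H (1 - x) - H x) @[x --> (0 : R)^'+] --> H 1 - H 0.
  apply: cvgB => //.
  (* The substitution [x |-> 1 - x] turns the right limit at 0 into the left limit of [H] at 1. *)
  apply: (@decreasing_cvg_at_right_comp _ (fun x => 1 - x) H 0 (BRight 1)).
  - by rewrite bnd_simp.
  - by move=> x y _ _ xy; rewrite ltrD2l ltrN2.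
  - apply: cvg_at_right_filter; apply: cvgB; [exact: cvg_cst|exact: cvg_id].
  - by rewrite subr0.
apply: cvg_trans L; apply: near_eq_cvg.
near=> x.
have x0 : 0 < x by near: x; exact: nbhs_right_gt.
(* Below one half, [[x, 1 - x]] is a non-degenerate interval. *)
have x2 : x < 2^-1 by near: x; apply: nbhs_right_lt; rewrite invr_gt0.
have xx : x < 1 - x by lra.
have I a : a \in `[x, 1 - x] -> 0 < a < 1.
  by rewrite in_itv /= => /andP[ax a1]; apply/andP; split; lra.
transitivity (\int[lebesgue_measure]_(a in `[x, 1 - x]) 'D_1 H a); last first.
  by apply: eq_Rintegral => a /[!inE] /= /I /GH ->.
rewrite /Rintegral (@continuous_FTC2 _ _ H _ _ xx) //.
- apply: continuous_in_subspaceT => a /[!inE] /= /I; exact: cH.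
- have cc a : a \in `[x, 1 - x] -> {for a, continuous H}.
    by move=> /I /dH; exact: differentiable_continuous.
  split.
  + move=> a ax; apply/derivable1_diffP/dH/I; exact: subset_itv_oo_cc ax.
  + by apply: cvg_at_right_filter; apply: cc; rewrite in_itv /= lexx ltW.
  + by apply: cvg_at_left_filter; apply: cc; rewrite in_itv /= lexx ltW.
- by move=> a _; rewrite derive1E.
Unshelve. all: by end_near. Qed.

End Calculus.

(** * The wedge product of a one-form and a two-form *)

Section Wedge.
Set Implicit Arguments.
Unset Strict Implicit.

Lemma sum_S3 (V : nmodType) (G : 'S_3 -> V) :
  let t01 := tperm (0 : 'I_3) 1 in let t12 := tperm (1 : 'I_3) 2%:R in
  \sum_s G s = G 1%g + (G t01 + (G t12 + (G (tperm 0 2%:R) +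
    (G (t01 * t12)%g + G (t12 * t01)%g)))).
Proof.
move=> t01 t12.
pose L : seq 'S_3 := [:: 1%g; t01; t12; tperm 0 2%:R; (t01 * t12)%g; (t12 * t01)%g].
(* The six permutations already differ in their images of 0 and 1. *)
have uL : uniq L.
  apply: (@map_uniq _ _ (fun s : 'S_3 => (val (s 0), val (s 1)))).
  by rewrite /= !permM !perm1 !permE /=.
(* Six distinct elements exhaust a group of order 3!. *)
have [sL eL] : (size L = size (index_enum 'S_3)) * (L =i index_enum 'S_3).
  apply: uniq_min_size => //; first by move=> s _; rewrite mem_index_enum.
  by have := card_Sn 3; rewrite cardE enumT => ->.
rewrite (perm_big L) /=; last first.
  by rewrite perm_sym; apply: uniq_perm => //; exact: index_enum_uniq.
by rewrite !big_cons big_nil addr0.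
Qed.

(** Permutations that differ by a swap of the two arguments of [beta] contribute equally, by
    antisymmetry; the six terms pair up and absorb the factor 1/2. *)
Lemma wedge12_args (R : realType) n (M : manifold R n) (theta : tensor 1 M)
    (beta : tensor 2 M) (m : M) :
  (forall u v, beta m (args [:: u; v]) = - beta m (args [:: v; u])) ->
  forall u v w, wedge theta beta m (args [:: u; v; w]) =
    theta m (args [:: u]) * beta m (args [:: v; w]) +
    theta m (args [:: v]) * beta m (args [:: w; u]) +
    theta m (args [:: w]) * beta m (args [:: u; v]).
Proof.
move=> anti u v w; rewrite /wedge.
pose x := @args R n 3 [:: u; v; w].
have tE (s : 'S_3) : theta m (fun i => x (s (lshift 2 i))) = theta m (args [:: x (s 0)]).
  congr (theta m); apply/funext => i; rewrite (ord1 i) /args /=.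
  by congr (x (s _)); apply: val_inj.
have bE (s : 'S_3) : beta m (fun i => x (s (rshift 1 i))) =
    beta m (args [:: x (s 1); x (s 2%:R)]).
  congr (beta m); apply/funext => -[[|[|//]] h]; rewrite /args /=;
  by congr (x (s _)); apply: val_inj.
rewrite (eq_bigr (fun s : 'S_3 => (-1) ^+ s * theta m (args [:: x (s 0)]) *
    beta m (args [:: x (s 1); x (s 2%:R)]))); last by move=> s _; rewrite -tE -bE.
have [x0 x1 x2] : [/\ x 0 = u, x 1 = v & x 2%:R = w] by [].
rewrite sum_S3 !odd_permM !odd_tperm odd_perm1 /= !permM !perm1 !permE /= !x0 !x1 !x2.
rewrite (anti v u) (anti w v) (anti u w) (_ : (1`! * 2`!)%N = 2%N) //.
by field.
Qed.

End Wedge.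

(** * Linear algebra of a unimodular pair *)

Section Plane.
Set Implicit Arguments.
Unset Strict Implicit.

Lemma sum_I2 (V : nmodType) (G : 'I_2 -> V) : \sum_i G i = G 0 + G 1.
Proof. by rewrite big_ord_recl big_ord1; congr (_ + G _); apply: val_inj. Qed.

(** Cramer's rule for the matrix with rows [(r1, r2)] and [(z1, z2)], of determinant 1, and
    right-hand side [(0, z1 * D + z2 * E)]. *)
Lemma unimodular_solve (R : comPzRingType) (r1 r2 z1 z2 D E : R) :
  r1 * z2 - r2 * z1 = 1 -> r1 * D + r2 * E = 0 ->
  D = (z1 * D + z2 * E) * - r2 /\ E = (z1 * D + z2 * E) * r1.
Proof.
move=> rz rDE; split.
- rewrite -[LHS]mulr1 -rz -[RHS]addr0 -[in RHS](mulr0 z2) -rDE; ring.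
- rewrite -[LHS]mulr1 -rz -[RHS]subr0 -[in RHS](mulr0 z1) -rDE; ring.
Qed.

(** The witness is [W = z1 X1 + z2 X2]: the change from [X1, X2] to [r.X, W] has determinant 1, and
    its inverse is read off at [r.X = 0]. *)
Lemma unimodular_span (R : comPzRingType) (V : lmodType R) (r1 r2 z1 z2 : R) (X1 X2 : V) :
  r1 * z2 - r2 * z1 = 1 -> r1 *: X1 + r2 *: X2 = 0 ->
  exists2 W : V, X1 = - r2 *: W & X2 = r1 *: W.
Proof.
move=> rz rX.
have e1 : r1 *: X1 = - (r2 *: X2) by apply/eqP; rewrite -addr_eq0 rX.
have e2 : r2 *: X2 = - (r1 *: X1) by rewrite e1 opprK.
exists (z1 *: X1 + z2 *: X2); rewrite -[LHS]scale1r -rz scalerBl.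
  rewrite (mulrC r1) -(scalerA z2) e1 scalerN scaleNr scalerDr opprD !scalerA.
  by rewrite (mulrC z2) addrC.
by rewrite (mulrC r2) -(scalerA z1) e2 scalerN opprK scalerDr !scalerA (mulrC z1) addrC.
Qed.

End Plane.

(** * Hamiltonian two-forms along an edge *)

Section Edges.
Set Implicit Arguments.
Unset Strict Implicit.
Context {R : realType} {n : nat} {B : manifold R n} (A : torus_action 2 B).
Context (tau : R -> B) (tau_cont : {within `[0%R, 1%R], continuous tau})
  (tau_smooth : @smooth_into R R^o n B `]0%R, 1%R[ tau).

Lemma edge_curve_diff (a : R) : 0 < a < 1 -> curve_diff tau a.
Proof. by move=> a01; apply: smooth_into_curve_diff tau_smooth _; rewrite /= in_itv. Qed.

Lemma edge_continuous (f : B -> R) :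
  (forall p, {for p, continuous f}) -> {within `[0%R, 1%R], continuous (f \o tau)}.
Proof.
by move=> fc; apply: within_continuous_comp tau_cont => p _; exact: fc.
Qed.

Section HamiltonianTwoForm.
Context (alpha : tensor 2 B) (al : is_form alpha) (ainv : invariant_tensor A alpha).
Context (f : B -> 'rV[R]_2) (sf : forall i, smooth_fun (fun p => f p 0 i))
  (k : R) (k0 : k != 0) (df : forall i p v,
     k * dfun (fun q => f q 0 i) p v = alpha p (args [:: generator A i p; v])).

(** The sign [k] will be 1 for [omega] and [mu], and -1 for [F] and [lambda]. With weights [k *: w],
    the derivative is in both cases [alpha] on the field generated by [w] and the velocity. *)
Let H (w : 'rV[R]_2) (a : R) : R := \sum_i w 0 i * f (tau a) 0 i.

(** Both partial velocities are push-forwards under [A (s *: Z)] of vectors at [tau a], so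
    invariance of [alpha] removes [s]. *)
Lemma pulled_back2_orbit (Z : 'rV[R]_2) (s a : R) : curve_diff tau a ->
  pulled_back2 alpha (fun s a => A (s *: Z) (tau a)) s a =
  alpha (tau a) (args [:: fundamental_field A Z (tau a); velocity tau a]).
Proof.
move=> ta; rewrite /pulled_back2 (act_curve A Z (tau a) s).2.
have [_ ->] := curve_diff_map ta (act_map_diff A (s *: Z) (tau a)).
by rewrite -[RHS](ainv (s *: Z)) pullback_args.
Qed.

Lemma derive_moment_curveE (w : 'rV[R]_2) (a : R) : 0 < a < 1 ->
  differentiable (H w) a /\
  'D_1 (H w) a = \sum_i w 0 i * 'D_1 ((fun p => f p 0 i) \o tau) a.
Proof.
move=> /edge_curve_diff ta.
have d i := (derive_fun_curve ta (smooth_fun_diff (tau a) (sf i))).1.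
have HE : H w = \sum_i (w 0 i *: ((fun p => f p 0 i) \o tau : R -> R)).
  by apply/funext => r; rewrite fct_sumE.
have dd i : differentiable (w 0 i *: ((fun p => f p 0 i) \o tau : R -> R)) a.
  exact: differentiableZ.
split; first by rewrite HE; apply: differentiable_sum.
rewrite HE derive_sum; last by move=> i; exact/diff_derivable/dd.
by apply: eq_bigr => i _; rewrite deriveZ //; exact: diff_derivable.
Qed.

Lemma derive_moment_curve (w : 'rV[R]_2) (a : R) : 0 < a < 1 ->
  'D_1 (H (k *: w)) a =
    alpha (tau a) (args [:: fundamental_field A w (tau a); velocity tau a]).
Proof.
move=> a01; have [_ ->] := derive_moment_curveE (k *: w) a01.
have := tensor_args_sum (form_smooth al) (tau a) [:: 0; velocity tau a] 0
  (fun j => w 0 j) (fun j => generator A j (tau a)).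
rewrite /= => ->; apply: eq_bigr => i _; rewrite -df mxE (mulrC k) -mulrA; congr (_ * (_ * _)).
exact: (derive_fun_curve (edge_curve_diff a01) (smooth_fun_diff _ (sf i))).2.
Qed.

Lemma moment_curve_continuous (w : 'rV[R]_2) : {within `[0%R, 1%R], continuous (H w)}.
Proof.
move=> a; apply: cvg_big => [|i _]; first exact: add_continuous.
apply: cvgM; first exact: cvg_cst.
apply: (edge_continuous (f := fun p => f p 0 i)) => p.
exact: (smooth_fun_diff p (sf i)).1.
Qed.

(** The inner integrand is free of [s] and equals the derivative of [H (k *: Z)], so the outer
    integral is an improper integral of a derivative. *)
Lemma surface_pairing_moment (Z : 'rV[R]_2) :
  surface_pairing A Z tau alpha = H (k *: Z) 1 - H (k *: Z) 0.
Proof.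
apply: lim_integral_derive.
- exact: moment_curve_continuous.
- by move=> a a01; have [] := derive_moment_curveE (k *: Z) a01.
- move=> a a01.
  have a01' : a \in `]0, 1[ by rewrite in_itv.
  have E : \forall s \near a, 'D_1 (H (k *: Z)) s =
      \sum_i (k *: Z) 0 i * 'D_1 ((fun p => f p 0 i) \o tau) s.
    have := near_in_itvoo a01'; apply: filterS => s; rewrite in_itv => s01.
    exact: (derive_moment_curveE (k *: Z) s01).2.
  have C : {for a, continuous (fun s => \sum_i (k *: Z) 0 i * 'D_1 ((fun p => f p 0 i) \o tau) s)}.
    apply: cvg_big => [|i _]; first exact: add_continuous.
    apply: cvgM; first exact: cvg_cst.
    by apply: (derive_fun_curve_continuous (sf i) _ tau_smooth) => //; exact: interval_open.
  rewrite /prop_for /continuous_at (nbhs_singleton E).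
  apply: cvg_trans C; apply: near_eq_cvg.
  by apply: filterS E => s ->.
- move=> a a01; rewrite derive_moment_curve //.
  transitivity (\int[lebesgue_measure]_(s in `[0%R, 1%R])
    alpha (tau a) (args [:: fundamental_field A Z (tau a); velocity tau a])).
    by apply: eq_Rintegral => s _; rewrite pulled_back2_orbit //; exact: edge_curve_diff.
  (* The unit interval has measure 1, so a constant is its own integral. *)
  rewrite Rintegral_cst //= lebesgue_measure_itv /= lte_fin ltr01 /=.
  by rewrite subr0 mulr1.
Qed.

Context (r1 r2 z1 z2 : R) (rz : r1 * z2 - r2 * z1 = 1).
Context (stab : forall a : R, 0 < a < 1 ->
  forall x : R, A (x *: row_of 2 [:: r1; r2]) (tau a) = tau a).

(** The derivative is [alpha] on the field generated by [r], which vanishes where [r] stabilises;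
    continuity extends the constancy to both vertices. *)
Lemma moment_stabiliser_const (a : R) : 0 < a <= 1 ->
  r1 * f (tau a) 0 0 + r2 * f (tau a) 0 1 = r1 * f (tau 0) 0 0 + r2 * f (tau 0) 0 1.
Proof.
move=> a01; pose r := row_of 2 [:: r1; r2].
have HE x : H (k *: r) x = k * (r1 * f (tau x) 0 0 + r2 * f (tau x) 0 1).
  by rewrite /H sum_I2 !mxE /= mulrDr !mulrA.
apply: (mulfI k0); rewrite -!HE; apply/eqP; rewrite -subr_eq0; apply/eqP.
rewrite (@increment_of_derive_cst _ (H (k *: r)) 0 a) ?mul0r //.
- exact: moment_curve_continuous.
- by move=> t t01; have [] := derive_moment_curveE (k *: r) t01.
- move=> t t01; rewrite derive_moment_curve //.
  rewrite (fundamental_field_stabiliser (stab t01)).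
  exact: (tensor_args0 (form_smooth al) (tau t) [:: 0; velocity tau t] 0).
Qed.

(** The increment of [r.f] is zero and that of [k z.f] is the pairing; the unimodular system then
    determines both components. *)
Lemma moment_increment :
  k *: (f (tau 1) - f (tau 0)) =
  surface_pairing A (row_of 2 [:: z1; z2]) tau alpha *: row_of 2 [:: - r2; r1].
Proof.
have c1 : r1 * f (tau 1) 0 0 + r2 * f (tau 1) 0 1 = r1 * f (tau 0) 0 0 + r2 * f (tau 0) 0 1.
  by apply: moment_stabiliser_const; rewrite ltr01 lexx.
rewrite surface_pairing_moment /H !sum_I2 !mxE /=.
have [e0 e1] := unimodular_solve rz (D := f (tau 1) 0 0 - f (tau 0) 0 0)
  (E := f (tau 1) 0 1 - f (tau 0) 0 1) ltac:(lra).
apply/rowP => -[[|[|//]] h]; rewrite !mxE /=.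
  have -> : Ordinal h = 0 :> 'I_2 by apply: val_inj.
  by rewrite {1}e0; ring.
have -> : Ordinal h = 1 :> 'I_2 by apply: val_inj.
by rewrite {1}e1; ring.
Qed.

End HamiltonianTwoForm.
End Edges.

(** * Descent of invariant functions to the base of the circle bundle *)

Section CircleBundle.
Set Implicit Arguments.
Unset Strict Implicit.
Context {R : realType} {n l : nat} {M : manifold R n} {B : manifold R l}.
Context (proj : M -> B) (rot : torus_action 1 M)
  (bundle : principal_circle_bundle proj rot).

Lemma proj_map_diff m : map_diff proj m.
Proof. exact: smooth_map_on_diff (proj_smooth bundle) I. Qed.

Lemma tangent_proj_generator m : tangent_map proj m (generator rot 0 m) = 0.
Proof.
have [c0 v0] := act_curve0 rot (delta_mx 0 0) m.
have [_] := curve_diff_map c0 (proj_map_diff (rot (0 *: delta_mx 0 0) m)).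
rewrite v0 scale0r act0 fundamental_field_delta => <-.
have -> : proj \o (fun u : R => rot (u *: delta_mx 0 0) m) = fun=> proj m.
  by apply/funext => u /=; rewrite (proj_rot bundle).
exact: velocity_cst.
Qed.

Section InvariantFunction.
Context {k : nat} (A : torus_action k M) (i : 'I_k)
  (Ai : forall m, generator A i m = generator rot 0 m).
Context (f : M -> R) (sf : smooth_fun f) (finv : invariant_fun A f).

(** [A] and [rot] are only assumed to share a generating field, so invariance passes through
    derivatives: [f] has derivative zero along every orbit of [rot]. *)
Lemma invariant_fun_rot s m : f (rot s m) = f m.
Proof.
have d0 q : dfun f q (generator rot 0 q) = 0.
  have [c0 v0] := act_curve0 A (delta_mx 0 i) q.
  have [_] := derive_fun_curve c0 (smooth_fun_diff _ sf).
  rewrite v0 scale0r act0 fundamental_field_delta Ai => <-.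
  have -> : f \o (fun u : R => A (u *: delta_mx 0 i) q) = fun=> f q.
    by apply/funext => u /=; rewrite finv.
  exact: derive_cst.
have -> : s = s 0 0 *: delta_mx 0 0.
  by apply/rowP => j; rewrite !ord1 !mxE mulr1.
pose c (u : R) := rot (u *: delta_mx 0 0) m.
have dc u : differentiable (f \o c) u /\ 'D_1 (f \o c) u = 0.
  have [cu _] := act_curve rot (delta_mx 0 0) m u.
  have [D E] := derive_fun_curve cu (smooth_fun_diff _ sf); split=> //.
  by rewrite E act_curve_velocity fundamental_field_delta d0.
have := cst_of_derive0 (fun u => (dc u).1) (fun u => (dc u).2) (s 0 0) 0.
by rewrite /c /= scale0r act0.
Qed.

Context (lift : B -> M) (liftK : forall p, proj (lift p) = p).

(** [lift] is any set-theoretic section. By local triviality both points are rotations of the same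
    value of a local section. *)
Lemma invariant_fun_lift m : f m = f (lift (proj m)).
Proof.
have [V [sigma [u [v [[_ Vb] _ _ tr _]]]]] := locally_trivial bundle (proj m).
have [t tE] := tr m Vb.
have [|t' tE'] := tr (lift (proj m)); first by rewrite liftK.
by rewrite {1}tE tE' !invariant_fun_rot liftK.
Qed.

Lemma near_section b : exists2 sigma : B -> M, map_diff sigma b &
  \forall p \near b, proj (sigma p) = p.
Proof.
have [V [sigma [u [v [[oV Vb] [ss sp] _ _ _]]]]] := locally_trivial bundle b.
exists sigma; first exact: smooth_map_on_diff ss Vb.
have : nbhs b V by exact: open_nbhs_nbhs.
by apply: filterS.
Qed.

(** [lift] itself may be discontinuous, but near [b] it can be traded for a local section without
    changing the value of [f]. *)
Lemma lifted_fun_continuous b : {for b, continuous (f \o lift)}.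
Proof.
have [sigma [cs _] E] := near_section b.
have C : {for b, continuous (f \o sigma)}.
  by apply: continuous_comp => //; exact: (smooth_fun_diff _ sf).1.
have {}E : \forall p \near b, (f \o sigma) p = (f \o lift) p.
  by apply: filterS E => p /= sp; rewrite (invariant_fun_lift (sigma p)) sp.
rewrite /prop_for /continuous_at -(nbhs_singleton E).
by apply: cvg_trans C; apply: near_eq_cvg; apply: filterS E => p ->.
Qed.

(** With a local section [sigma] in place of [lift], the point is [sigma (tau a)] and [w] is the
    velocity of [sigma \o tau], which projects to that of [tau]. *)
Lemma derive_lifted_fun (tau : R -> B) (a : R) : curve_diff tau a ->
  differentiable (f \o lift \o tau) a /\
  exists m w, [/\ proj m = tau a, tangent_map proj m w = velocity tau a &
    'D_1 (f \o lift \o tau) a = dfun f m w].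
Proof.
move=> ta; have [sigma ds E] := near_section (tau a).
have [cc cv] := curve_diff_map ta ds.
have [D DE] := derive_fun_curve cc (smooth_fun_diff _ sf).
have [cc' cv'] := curve_diff_map cc (proj_map_diff _).
have N : \forall s \near a, proj (sigma (tau s)) = tau s by exact: ta.1 E.
have {}E : \forall s \near a, (f \o (sigma \o tau)) s = (f \o lift \o tau) s.
  by apply: filterS N => s /= sp; rewrite (invariant_fun_lift (sigma _)) sp.
split; first exact: near_eq_differentiable E D.
exists (sigma (tau a)), (velocity (sigma \o tau) a); split.
- exact: nbhs_singleton N.
- rewrite -cv' /velocity /diff_into /= (nbhs_singleton N).
  by apply: near_eq_derive; apply: filterS N => s /= ->.
- by rewrite -(near_eq_derive _ E).
Qed.

End InvariantFunction.
End CircleBundle.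

(** * The three-form on the lifted generators *)

Section G2Form.
Set Implicit Arguments.
Unset Strict Implicit.
Context {R : realType} {n l : nat} {M : manifold R n} {B : manifold R l}.
Context (proj : M -> B) (rot : torus_action 1 M)
  (bundle : principal_circle_bundle proj rot).
Context (theta : tensor 1 M) (htheta : connection_form rot theta).
Context (omega : tensor 2 B) (om : is_form omega) (psip : tensor 3 B) (ps : is_form psip).
Context (A : torus_action 2 B) (lambda : B -> 'rV[R]_2) (A3 : torus_action 3 M)
  (hA3 : lifted_action proj rot theta A lambda A3) (h : B -> R).

Lemma g2_form_args (m : M) (u v w : 'rV[R]_n) :
  let T := tangent_map proj m in
  g2_form proj theta omega psip h m (args [:: u; v; w]) =
  theta m (args [:: u]) * omega (proj m) (args [:: T v; T w]) +
  theta m (args [:: v]) * omega (proj m) (args [:: T w; T u]) +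
  theta m (args [:: w]) * omega (proj m) (args [:: T u; T v]) +
  h (proj m) `^ (3 / 4) * psip (proj m) (args [:: T u; T v; T w]).
Proof.
have pb (k : nat) (beta : tensor k B) s : size s = k ->
    pullback proj beta m (args s) = beta (proj m) (args (map (tangent_map proj m) s)).
  exact: pullback_args.
rewrite /g2_form wedge12_args => [|x y]; last by rewrite !pb //; exact: form2_antisym.
by congr (_ * _ + _ * _ + _ * _ + _); exact: pb.
Qed.

(** Apply [theta] and the differential of [proj] to the relations defining the lifts: [U_3] is
    vertical with [theta(U_3) = 1], so it contributes to [theta] only. *)
Lemma lifted_generators (m : M) :
  let T := tangent_map proj m in let p := proj m in
  [/\ theta m (args [:: generator A3 0 m]) = lambda p 0 1,
      theta m (args [:: generator A3 1 m]) = - lambda p 0 0,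
      T (generator A3 0 m) = generator A 1 p &
      T (generator A3 1 m) = - generator A 0 p].
Proof.
move=> T p.
have Tl : linear T := tangent_map_linear (proj_map_diff bundle m).
have T3 : T (generator rot 0 m) = 0 := tangent_proj_generator bundle m.
have [] := hA3 m; rewrite /horizontal_lift -/T -/p => -[+ +] [].
have thl a u v := tensor_args_linear (form_smooth (connection_smooth htheta)) m
   [:: 0] 0 a u v.
rewrite /= in thl.
have := connection_normalised htheta m.
move: T3; move: (generator A3 0 m) (generator A3 1 m) (generator rot 0 m) => U0 U1 U3.
move: (generator A 0 p) (generator A 1 p) (lambda p 0 0) (lambda p 0 1) => X1 X2 l0 l1.
move=> T3 th3 th0 T0 th1 T1 _.
have TD (u v : 'rV[R]_n) : T (u + v) = T u + T v by rewrite -[u]scale1r Tl !scale1r.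
have TZ a u : T (a *: u) = a *: T u.
  have T00 : T 0 = 0 by exact: derive0.
  by rewrite -[a *: u]addr0 Tl T00 addr0.
have thD (u v : 'rV[R]_n) :
    theta m (args [:: u + v]) = theta m (args [:: u]) + theta m (args [:: v]).
  by rewrite -[u]scale1r thl scale1r mul1r.
have thZ a (u : 'rV[R]_n) : theta m (args [:: a *: u]) = a * theta m (args [:: u]).
  exact: (tensor_argsZ (form_smooth (connection_smooth htheta)) m [:: 0] 0).
rewrite thD -scaleNr thZ th3 in th0; rewrite thD -scaleNr -scaleN1r !thZ th3 in th1.
rewrite TD -scaleNr TZ T3 scaler0 addr0 in T0.
rewrite TD -scaleNr -scaleN1r !TZ T3 scaler0 addr0 scaleN1r in T1.
split; [lra|lra|exact: T0|by rewrite -T1 opprK].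
Qed.

(** Where [r.X] vanishes, [X_1] and [X_2] are multiples of one vector, which kills the [psip] term
    and [omega(X_1, X_2)]; the rest comes from the vertical parts of [U_1] and [U_2]. *)
Lemma g2_form_generators (m : M) (w : 'rV[R]_n) (r1 r2 z1 z2 : R) :
  r1 * z2 - r2 * z1 = 1 ->
  fundamental_field A (row_of 2 [:: r1; r2]) (proj m) = 0 ->
  g2_form proj theta omega psip h m
    (args [:: generator A3 0 m; generator A3 1 m; w]) =
  lambda (proj m) 0 0 *
    omega (proj m) (args [:: generator A 1 (proj m); tangent_map proj m w]) -
  lambda (proj m) 0 1 *
    omega (proj m) (args [:: generator A 0 (proj m); tangent_map proj m w]).
Proof.
move=> rz; rewrite /fundamental_field sum_I2 !mxE /= => /(unimodular_span rz)[W X1E X2E].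
rewrite g2_form_args; move: (lifted_generators m); cbv zeta.
generalize (generator A3 0 m) (generator A3 1 m) => U0 U1 [-> -> -> ->].
set p := proj m; move: (tangent_map proj m w) => v.
rewrite X1E X2E -scaleN1r scalerA.
move: (theta m (args [:: w])) (h p `^ (3 / 4)) => c d.
rewrite !(form2_Z om p) (form2_alternating om p).
have -> a b : psip p (args [:: a *: W; b *: W; v]) = 0.
  rewrite (tensor_argsZ (form_smooth ps) p [:: 0; b *: W; v] 0).
  rewrite (tensor_argsZ (form_smooth ps) p [:: W; 0; v] 1) /=.
  by rewrite (form_alternating ps _ _ (i := 0) (j := 1)) ?mulr0.
rewrite (form2_antisym om p v W); ring.
Qed.
End G2Form.

(** * Increments of [mu], [lambda] and [nu] between the two vertices *)

Theorem mainTheorem2 (R : realType)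
    (B : manifold R 6) (g omega : tensor 2 B) (psip psim : tensor 3 B)
    (hSU3 : symplectic_SU3 g omega psip psim)
    (A : torus_action 2 B) (hAeff : effective A)
    (hAg : invariant_tensor A g) (hAomega : invariant_tensor A omega)
    (hApsip : invariant_tensor A psip) (hApsim : invariant_tensor A psim)
    (mu : B -> 'rV[R]_2) (hmu : is_moment_map A omega mu)
    (M : manifold R 7) (proj : M -> B) (rot : torus_action 1 M)
    (hbundle : principal_circle_bundle proj rot)
    (theta : tensor 1 M) (htheta : connection_form rot theta)
    (F : tensor 2 B) (hF : is_form F) (hFclosed : closed_form F)
    (hFinv : invariant_tensor A F) (hFint : integral_periods F)
    (hcurv : forall m v, ext_d theta m v = pullback proj F m v)
    (lambda : B -> 'rV[R]_2)
    (hlambda_smooth : forall i, smooth_fun (fun p => lambda p 0 i))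
    (hlambda : forall i p v, dfun (fun q => lambda q 0 i) p v =
                             - F p (args [:: generator A i p; v]))
    (A3 : torus_action 3 M) (hA3eff : effective A3)
    (hA3 : lifted_action proj rot theta A lambda A3)
    (hA3theta : invariant_tensor A3 theta)
    (h : B -> R) (hh_smooth : smooth_fun h) (hh_pos : forall p, 0 < h p)
    (hh_inv : invariant_fun A h)
    (hphi : closed_form (g2_form proj theta omega psip h))
    (nu : M -> 'rV[R]_3)
    (hnu : is_multi_moment_map A3 (g2_form proj theta omega psip h) nu)
    (hnumu : forall m, nu m 0 0 = mu (proj m) 0 0 /\ nu m 0 1 = mu (proj m) 0 1)
    (e : set (orbit_space A)) (he : open_edge e)
    (b c : B) (hbc : edge_joins e b c)
    (r1 r2 : int) (hr : coprimez r1 r2)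
    (hstab : forall p, e (orbit_pt A p) ->
       stabiliser_generated_by A p (row_of 2 [:: r1%:~R; r2%:~R]))
    (z1 z2 : int) (hz : r1 * z2 - r2 * z1 = 1)
    (tau : R -> B) (htau : edge_path mu e b c tau) :
  let Z : 'rV[R]_2 := row_of 2 [:: z1%:~R; z2%:~R] in
  let t := surface_pairing A Z tau omega in
  [/\ mu c - mu b = t *: row_of 2 [:: - r2%:~R; r1%:~R],
      lambda c - lambda b =
        - surface_pairing A Z tau F *: row_of 2 [:: - r2%:~R; r1%:~R] &
      forall mb mc : M, proj mb = b -> proj mc = c ->
        nu mc - nu mb = t *: row_of 3 [:: - r2%:~R; r1%:~R;
          r1%:~R * lambda b 0 0 + r2%:~R * lambda b 0 1] /\
        nu mc - nu mb = t *: row_of 3 [:: - r2%:~R; r1%:~R;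
          r1%:~R * lambda c 0 0 + r2%:~R * lambda c 0 1]].
Proof.
move=> Z t.
have [_ hmu'] := hmu.
have smu i := (hmu' i).1.
have dmu i p v := (hmu' i).2 p v.
have [tau_c tau_s tau0 tau1 tau_e tau_mu] := htau.
have rz : r1%:~R * z2%:~R - r2%:~R * z1%:~R = 1 :> R.
  by rewrite -!intrM -intrB hz.
have stab (a : R) : 0 < a < 1 ->
    forall x : R, A (x *: row_of 2 [:: r1%:~R; r2%:~R]) (tau a) = tau a.
  move=> a01 x; apply/(hstab _ (tau_e a a01)); exists x => i.
  by rewrite subrr mxE.
have mu_inc : mu c - mu b = t *: row_of 2 [:: - r2%:~R; r1%:~R].
  rewrite -tau0 -tau1 -[LHS]scale1r.
  apply: (moment_increment tau_c tau_s (SU3_omega hSU3) hAomega smu (oner_neq0 R) _ rz stab).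
  by move=> i p v; rewrite mul1r.
(* The sign in [d lambda_i = - F(X_i, .)] makes this the case [k = -1]. *)
have dlambda i p v : -1 * dfun (fun q => lambda q 0 i) p v = F p (args [:: generator A i p; v]).
  by rewrite hlambda mulN1r opprK.
have N10 : -1 != 0 :> R by rewrite oppr_eq0 oner_neq0.
have la_inc : lambda c - lambda b =
    - surface_pairing A Z tau F *: row_of 2 [:: - r2%:~R; r1%:~R].
  apply: oppr_inj; rewrite -[LHS]scaleN1r -[RHS]scaleNr opprK -tau0 -tau1.
  exact: (moment_increment tau_c tau_s hF hFinv hlambda_smooth N10 dlambda rz stab).
have la_const (a : R) : 0 < a <= 1 ->
    r1%:~R * lambda (tau a) 0 0 + r2%:~R * lambda (tau a) 0 1 =
    r1%:~R * lambda b 0 0 + r2%:~R * lambda b 0 1.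
  rewrite -tau0.
  exact: (moment_stabiliser_const tau_c tau_s hF hlambda_smooth N10 dlambda stab).
(* As [r.lambda] agrees at the two vertices, both expressions for the third component reduce to
   [t * k]. *)
set k := r1%:~R * lambda b 0 0 + r2%:~R * lambda b 0 1 in la_const *.
have -> : r1%:~R * lambda c 0 0 + r2%:~R * lambda c 0 1 = k.
  by rewrite -(la_const 1) ?tau1 // ltr01 lexx.
(* A pointwise choice in the fibres, which are non-empty by local triviality. *)
have /choice[lift liftK] : forall p, exists m, proj m = p.
  move=> p; have [V [sigma [u [v [[_ Vp] [_ sp] _ _ _]]]]] := locally_trivial hbundle p.
  by exists (sigma p); exact: sp.
have [nu_inv nu_d] := hnu.
pose f (m : M) := nu m 0 2%:R.
have sf : smooth_fun f := (nu_d 2%:R).1.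
have f_inv : invariant_fun A3 f by move=> s m; rewrite /f nu_inv.
have A3_rot m : generator A3 2%:R m = generator rot 0 m by have [] := hA3 m.
(* [mu \o tau] is affine on [[0, 1]], so its derivative at an interior point is [mu c - mu b]. *)
have dmu_tau (a : R) i : 0 < a < 1 ->
    omega (tau a) (args [:: generator A i (tau a); velocity tau a]) = (mu c - mu b) 0 i.
  move=> a01; rewrite -dmu.
  have ca := edge_curve_diff tau_s a01.
  have [_ <-] := derive_fun_curve ca (smooth_fun_diff _ (smu i)).
  have E : \forall s \near a, (cst (mu b 0 i) + (mu c - mu b) 0 i *: id : R -> R) s =
      ((fun q => mu q 0 i) \o tau) s.
    have a01' : a \in `]0, 1[ by rewrite in_itv.
    have := near_in_itvoo a01'; apply: filterS => s /=; rewrite in_itv /= => /andP[s0 s1].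
    rewrite tau_mu ?(ltW s0) ?(ltW s1) // !mxE -[LHS]/(mu b 0 i + (mu c 0 i - mu b 0 i) * s); ring.
  rewrite -(near_eq_derive _ E) deriveD // derive_cst add0r deriveZ // derive_id.
  exact: mulr1.
have nu_inc : f (lift c) - f (lift b) = t * k.
  have d (a : R) : 0 < a < 1 -> differentiable (f \o lift \o tau) a /\
      'D_1 (f \o lift \o tau) a = t * k.
    move=> a01; have ca := edge_curve_diff tau_s a01.
    have [D [m [w [pm Tw Dw]]]] := derive_lifted_fun hbundle A3_rot sf f_inv liftK ca.
    split=> //; rewrite Dw (nu_d 2%:R).2.
    (* Indices are shifted by one and taken modulo 3: [d nu_3] involves [U_1] and [U_2], numbered 0
       and 1. *)
    have -> : 2%:R + 1 = 0 :> 'I_3 by apply: val_inj.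
    have -> : 2%:R + 2%:R = 1 :> 'I_3 by apply: val_inj.
    rewrite (g2_form_generators hbundle htheta (SU3_omega hSU3) (SU3_psip hSU3) hA3 h w rz).
      (* Here [lambda_1 (t r_1) - lambda_2 (- t r_2) = t (r.lambda)]. *)
      rewrite pm Tw !dmu_tau // mu_inc !mxE /= -(la_const a); last first.
        by case/andP: a01 => -> /ltW.
      ring.
    by rewrite pm; apply: fundamental_field_stabiliser; exact: stab.
  have fc : {within `[0%R, 1%R], continuous ((f \o lift) \o tau)}.
    apply: (edge_continuous tau_c) => p.
    exact: (lifted_fun_continuous hbundle A3_rot sf f_inv liftK).
  have b01 : 0 < (1 : R) <= 1 by rewrite ltr01 lexx.
  have := increment_of_derive_cst b01 fc (fun a a01 => (d a a01).1)
    (fun a a01 => (d a a01).2).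
  by rewrite /= tau0 tau1 mulr1.
suff nuE mb mc : proj mb = b -> proj mc = c ->
    nu mc - nu mb = t *: row_of 3 [:: - r2%:~R; r1%:~R; k] by split=> // mb mc /nuE h1 /h1.
move=> pb pc; apply/rowP => -[[|[|[|//]]] lt3]; rewrite !mxE /=.
- have -> : Ordinal lt3 = 0 :> 'I_3 by apply: val_inj.
  rewrite (hnumu mb).1 (hnumu mc).1 pb pc.
  by have /rowP/(_ 0) := mu_inc; rewrite !mxE.
- have -> : Ordinal lt3 = 1 :> 'I_3 by apply: val_inj.
  rewrite (hnumu mb).2 (hnumu mc).2 pb pc.
  by have /rowP/(_ 1) := mu_inc; rewrite !mxE.
- have -> : Ordinal lt3 = 2%:R :> 'I_3 by apply: val_inj.
  (* [f] depends only on the fibre, so [mb] and [mc] may be replaced by the chosen points. *)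
  rewrite -/(f mb) -/(f mc) (invariant_fun_lift hbundle A3_rot sf f_inv liftK mb).
  by rewrite (invariant_fun_lift hbundle A3_rot sf f_inv liftK mc) pb pc.
Qed.
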